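(* For each positive integer $n$ let $\mathcal{P}_n\subset\mathbb{R}^n$ be the convex hull of all parking functions of length $n$, let $V_n=\mathrm{Vol}(\mathcal{P}_n)$ be its $n$-dimensional volume, and let $V_0=1$. Let $$f(x)=\sum_{n\ge 0}\frac{V_n}{n!}x^n,\qquad g(x)=\sum_{n\ge 1}\frac{n^{n-1}}{n!}x^n$$ be the exponential generating functions of $\{V_n\}_{n\ge0}$ and $\{n^{n-1}\}_{n\ge1}$. Then, as formal power series, $$f(x)=\exp\left(\int \frac{x\,(g'(x))^2}{2}\,dx\right),$$ where $\int$ denotes the formal antiderivative with zero constant term.
   Context: A sequence $\alpha=(a_1,\dots,a_n)$ with $a_i\in\{1,\dots,n\}$ is a parking function of length $n$ if its weakly increasing rearrangement $b_1\le b_2\le\dots\le b_n$ satisfies $b_i\le i$ for all $i\in\{1,\dots,n\}$. Volume is $n$-dimensional Lebesgue measure on $\mathbb{R}^n$; in particular $V_1=0$ since $\mathcal{P}_1=\{1\}$ is a point. *)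

(* Defs.v *)
From HB Require Import structures.
From mathcomp Require Import all_boot all_order all_algebra.
From mathcomp Require Import all_classical all_reals all_analysis.

Set Implicit Arguments.
Unset Strict Implicit.
Unset Printing Implicit Defensive.

Import Order.TTheory GRing.Theory Num.Theory.
Import numFieldNormedType.Exports.

Local Open Scope classical_set_scope.
Local Open Scope ring_scope.

Section FormalPowerSeries.
Context {K : fieldType}.

(* The series \sum_n (a n) x^n. This alias keeps [fps_mul] (the Cauchy product)
   apart from the pointwise product of functions. *)
Definition fps : Type := nat -> K.
Implicit Types a b h : fps.

Definition fps_one : fps := fun n => (n == 0)%:R.
Definition fps_X : fps := fun n => (n == 1)%:R.
Definition fps_scale (c : K) a : fps := fun n => c * a n.
Definition fps_mul a b : fps := fun n => \sum_(i < n.+1) a i * b (n - i)%N.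
Definition fps_pow a k : fps := iter k (fps_mul a) fps_one.
Definition fps_deriv a : fps := fun n => n.+1%:R * a n.+1.
Definition fps_int a : fps := fun n => if n is m.+1 then a m / m.+1%:R else 0.

(* Meaningful only if h 0 = 0. Then h^k has no term of degree < k, so that
   \sum_k h^k / k! contributes to x^n only through k <= n; see [fps_expE]. *)
Definition fps_exp h : fps :=
  fun n => \sum_(k < n.+1) fps_pow h k n / k`!%:R.

Definition egf (a : nat -> K) : fps := fun n => a n / n`!%:R.

Lemma fps_pow_eq0 h k n : h 0%N = 0 -> (n < k)%N -> fps_pow h k n = 0.
Proof.
move=> h0; elim: k n => // k IHk n nk.
rewrite (_ : fps_pow h k.+1 n = \sum_(i < n.+1) h i * fps_pow h k (n - i)%N)//.
apply: big1 => -[[|i] /= iP] _; first by rewrite h0 mul0r.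
by rewrite IHk ?mulr0// (leq_trans _ (nk : (n <= k)%N))// ltn_subrL; case: n {nk} iP.
Qed.

Lemma fps_expE h n m : h 0%N = 0 -> (n < m)%N ->
  \sum_(k < m) fps_pow h k n / k`!%:R = fps_exp h n.
Proof.
move=> h0 nm; rewrite /fps_exp.
rewrite (big_ord_widen m (fun k => fps_pow h k n / k`!%:R) nm) [RHS]big_mkcond /=.
apply: eq_bigr => k _; case: ltnP => // nk.
by rewrite fps_pow_eq0 ?mul0r.
Qed.

End FormalPowerSeries.
Arguments fps : clear implicits.

(* Lebesgue measure on n-tuples of reals, with the product sigma-algebra: the
   n-fold product of [lebesgue_measure]; for n = 0 it is the unit mass at the
   empty tuple. *)
Fixpoint lebesgue_tuple {R : realType} n :
    set (n.-tuple (measurableTypeR R)) -> \bar R :=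
  match n with
  | 0 => \d_[tuple]
  | m.+1 => pushforward (lebesgue_measure \x lebesgue_tuple (n := m))%E
              (fun p => [tuple of p.1 :: p.2])
  end.
Arguments lebesgue_tuple {R} n.

Lemma sigma_finite_product d1 d2 (T1 : measurableType d1) (T2 : measurableType d2)
  (R : realType) (m1 : {sigma_finite_measure set T1 -> \bar R})
  (m2 : {sigma_finite_measure set T2 -> \bar R}) :
  sigma_finite setT (m1 \x m2)%E.
Proof.
have /sigma_finiteP[F [TF ndF Foo]] := sigma_finiteT m1.
have /sigma_finiteP[G [TG ndG Goo]] := sigma_finiteT m2.
exists (fun n => F n `*` G n).
  rewrite -setXTT TF TG predeqE => -[x y]; split.
    move=> [/= [n _ Fnx] [k _ Gky]]; exists (maxn n k) => //; split.
    - by move: x Fnx; exact/subsetPset/ndF/leq_maxl.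
    - by move: y Gky; exact/subsetPset/ndG/leq_maxr.
  by move=> [n _ []/= ? ?]; split; exists n.
move=> k; have [? ?] := Foo k; have [? ?] := Goo k.
split; first exact: measurableX.
by rewrite product_measure1E// lte_mul_pinfty// ge0_fin_numE.
Qed.

Section LebesgueTuple.
Context {R : realType}.
Local Notation mR := (measurableTypeR R).
Local Open Scope ereal_scope.

Section Step.
Context n (m : {sigma_finite_measure set (n.-tuple mR) -> \bar R}).

Let f (p : mR * n.-tuple mR) := [tuple of p.1 :: p.2].

Let mf : measurable_fun setT f. Proof. exact: measurable_cons. Qed.

Let nu : set (n.+1.-tuple mR) -> \bar R := pushforward (lebesgue_measure \x m) f.

Let nu0 : nu set0 = 0.
Proof. by rewrite /nu /pushforward preimage_set0 measure0. Qed.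

Let nu_ge0 A : 0 <= nu A. Proof. exact: measure_ge0. Qed.

Let nu_sigma_additive : semi_sigma_additive nu.
Proof. by apply: measure_semi_sigma_additive; exact: mf. Qed.

HB.instance Definition _ := isMeasure.Build _ _ _ nu nu0 nu_ge0 nu_sigma_additive.

Let nu_sigma_finite : sigma_finite setT nu.
Proof.
have [F FT Foo] := sigma_finite_product lebesgue_measure m.
exists (fun k => [set t | F k (thead t, [tuple of behead t])]).
  apply/esym; rewrite -subTset => t _.
  have : setT (thead t, [tuple of behead t]) by [].
  by rewrite FT => -[k _ Fk]; exists k.
move=> k; have [mF Fk] := Foo k; split.
  rewrite -[X in measurable X]setTI.
  have : measurable_fun setT (fun t : n.+1.-tuple mR =>
      (thead t, [tuple of behead t] : n.-tuple mR)).
    by apply: measurable_fun_pair;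
      [exact: measurable_tnth|exact: measurable_behead].
  by apply.
rewrite /nu /pushforward (_ : _ @^-1` _ = F k)//.
have fK (z : mR * n.-tuple mR) : (thead (f z), [tuple of behead (f z)]) = z.
  by case: z => x t; congr pair; exact: val_inj.
by apply/seteqP; split=> z /=; rewrite fK.
Qed.

HB.instance Definition _ := Measure_isSigmaFinite.Build _ _ _ nu nu_sigma_finite.

Definition cons_measure : {sigma_finite_measure set (n.+1.-tuple mR) -> \bar R} := nu.

End Step.

Let lebesgue_tuple_ex n :
  {m : {sigma_finite_measure set (n.-tuple mR) -> \bar R} |
    m = lebesgue_tuple n :> (set _ -> \bar R)}.
Proof.
elim: n => [|n [m mE]]; first by exists (\d_([tuple] : 0.-tuple mR)).
by exists (cons_measure m); rewrite /= -mE.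
Qed.

Let lebesgue_tuple0 n : lebesgue_tuple n set0 = 0 :> \bar R.
Proof. by case: (lebesgue_tuple_ex n) => m <-; exact: measure0. Qed.

Let lebesgue_tuple_ge0 n (A : set (n.-tuple mR)) : 0 <= lebesgue_tuple n A.
Proof. by case: (lebesgue_tuple_ex n) => m <-; exact: measure_ge0. Qed.

Let lebesgue_tuple_sigma_additive n :
  semi_sigma_additive (@lebesgue_tuple R n).
Proof.
by case: (lebesgue_tuple_ex n) => m <-; exact: measure_semi_sigma_additive.
Qed.

HB.instance Definition _ n := isMeasure.Build _ _ _ (@lebesgue_tuple R n)
  (lebesgue_tuple0 n) (@lebesgue_tuple_ge0 n) (@lebesgue_tuple_sigma_additive n).

Let lebesgue_tuple_sigma_finite n : sigma_finite setT (@lebesgue_tuple R n).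
Proof. by case: (lebesgue_tuple_ex n) => m <-; exact: sigma_finiteT. Qed.

HB.instance Definition _ n := Measure_isSigmaFinite.Build _ _ _
  (@lebesgue_tuple R n) (@lebesgue_tuple_sigma_finite n).

(* The usual normalization of Lebesgue measure on R^n. *)
Lemma lebesgue_tuple_box n (a b : 'I_n -> R) : (forall i, a i <= b i)%R ->
  lebesgue_tuple n [set t | forall i, tnth t i \in `[a i, b i]%R] =
  (\prod_(i < n) (b i - a i))%:E.
Proof.
elim: n => [|n IHn] in a b *; move=> ab.
  rewrite big_ord0 /= diracE mem_set//; by case.
rewrite big_ord_recl EFinM -IHn//=.
rewrite /pushforward (_ : _ @^-1` _ = `[a ord0, b ord0]%classic `*`
  [set t | forall i, tnth t i \in `[a (lift ord0 i), b (lift ord0 i)]]).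
  rewrite product_measure1E//=.
    rewrite lebesgue_measure_itv/= lte_fin EFinB.
    by case: ltgtP (ab ord0) => // -> _; rewrite subee.
  rewrite (_ : [set _ | _] = \bigcap_(i in [set: 'I_n])
    ((fun t : n.-tuple mR => tnth t i) @^-1`
      `[a (lift ord0 i), b (lift ord0 i)]%classic)).
    apply: fin_bigcap_measurable => // i _; rewrite -[X in measurable X]setTI.
    by apply: measurable_tnth => //; exact: measurable_itv.
  by apply/seteqP; split=> t /= h i; [move=> _|]; exact: h.
apply/seteqP; split=> -[x t] /=.
  by move=> h; split=> [|i]; [exact: (h ord0)|have := h (lift ord0 i); rewrite tnthS].
by move=> [h0 h] i; case: (unliftP ord0 i) => [j ->|->]; rewrite ?tnthS ?h ?tnth0.
Qed.

End LebesgueTuple.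

(* 'rV[R]_n carries no sigma-algebra in the library, hence the passage through
   tuples. As [fine +oo = 0], use this only on sets of finite measure. *)
Definition volume {R : realType} n (A : set 'rV[R]_n) : R :=
  fine (lebesgue_tuple n
    [set t : n.-tuple (measurableTypeR R) | A (\row_i tnth t i)]).

Definition convex_hull {R : numDomainType} {E : lmodType R} (A : set E) : set E :=
  smallest (@convex_set R E) A.

(* Positions are 0-based: b_(i+1) <= i+1 for the sorted sequence b. *)
Definition is_parking_function n (a : n.-tuple nat) : Prop :=
  (forall i, 1 <= tnth a i <= n)%N /\
  (forall i : 'I_n, nth 0%N (sort leq a) i <= i.+1)%N.

Definition parking_polytope (R : realType) n : set 'rV[R]_n :=
  convex_hull [set \row_i (tnth a i)%:R | a in [set a | @is_parking_function n a]].

Arguments parking_polytope : clear implicits.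

Definition parking_volume (R : realType) n : R :=
  if n is 0 then 1 else volume (parking_polytope R n).

(* Main.v *)
From HB Require Import structures.
Require Import Defs.
From mathcomp Require Import all_boot all_order all_algebra.
From mathcomp Require Import all_classical all_reals all_analysis.
From mathcomp Require Import measurable_realfun ring lra zify.

Set Implicit Arguments.
Unset Strict Implicit.
Unset Printing Implicit Defensive.

Import Order.TTheory GRing.Theory Num.Theory.
Import numFieldNormedType.Exports.
Local Open Scope ring_scope.

(* Write r_n(k) = (n-1) + ... + (n-k). By a theorem of Rado, P_n is the polymatroid of
   the x with x_i >= 1 and \sum_(i in U) (x_i - 1) <= r_n(|U|) for all U. For x in the
   box [1, n]^n, the function S |-> \sum_(i in S) (x_i - 1) - r_n(|S|) is supermodular,
   and S maximizes it iff the restriction of x to the complement of S lies in P_(n-|S|)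
   and the restriction of n + 1 - x to S lies in P_|S|. For almost all x the maximizer is
   unique, so the box is cut into cells of volume V_|S| * V_(n-|S|), whence
     \sum_k 'C(n, k) V_k V_(n-k) = (n - 1)^n,   that is,   f^2 = \sum_n (n - 1)^n x^n / n!.
   Abel's identities for g then give (f^2)' = x (g')^2 f^2, and a formal power series with
   constant term 1 is determined by its logarithmic derivative. *)

(** * Formal power series *)

HB.instance Definition _ (K : fieldType) := GRing.Zmodule.copy (fps K) (nat -> K).

Section FpsRing.
Variable K : fieldType.
Implicit Types a b c : fps K.

Let P N a : {poly K} := \poly_(i < N) a i.

(** Coefficient n of a product involves only coefficients up to n, so truncation imports the ring
    laws from polynomials. *)
Lemma fps_mul_poly N a b n : (n < N)%N -> fps_mul a b n = (P N a * P N b)`_n.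
Proof.
move=> nN; rewrite coefM; apply: eq_bigr => i _; rewrite !coef_poly.
by rewrite (leq_ltn_trans (leq_subr _ _) nN) (leq_trans (ltn_ord i) nN).
Qed.

Lemma fps_mulC : commutative (@fps_mul K).
Proof. by move=> a b; apply/funext => n; rewrite !(@fps_mul_poly n.+1)// mulrC. Qed.

Lemma fps_mulA : associative (@fps_mul K).
Proof.
move=> a b c; apply/funext => n.
have -> : fps_mul a (fps_mul b c) n = (P n.+1 a * (P n.+1 b * P n.+1 c))`_n.
  rewrite coefM; apply: eq_bigr => i _; rewrite coef_poly ltn_ord.
  by rewrite -fps_mul_poly// ltnS leq_subr.
rewrite mulrA coefM; apply: eq_bigr => i _; rewrite -fps_mul_poly//.
by rewrite coef_poly ltnS leq_subr.
Qed.

Lemma fps_mul1 : left_id (@fps_one K) (@fps_mul K).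
Proof.
move=> a; apply/funext => n; rewrite /fps_mul big_ord_recl big1 ?addr0 => [|i _].
  by rewrite /fps_one mul1r subn0.
by rewrite /fps_one mul0r.
Qed.

Lemma fps_mulDl : left_distributive (@fps_mul K) +%R.
Proof.
move=> a b c; apply/funext => n; rewrite [RHS]/GRing.add/= /fps_mul -big_split.
by apply: eq_bigr => i _; exact: mulrDl.
Qed.

Lemma fps_one_neq0 : (@fps_one K) != 0.
Proof. by apply/eqP => /(congr1 (@^~ 0%N))/eqP; rewrite /fps_one oner_eq0. Qed.

End FpsRing.

HB.instance Definition _ (K : fieldType) := GRing.Zmodule_isComNzRing.Build (fps K)
  (@fps_mulA K) (@fps_mulC K) (@fps_mul1 K) (@fps_mulDl K) (@fps_one_neq0 K).

Section FpsTheory.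
Variable K : fieldType.
Implicit Types a b c h u v w : fps K.

Lemma fps_coef1 n : (1 : fps K) n = (n == 0)%:R. Proof. by []. Qed.
Lemma fps_coefD a b n : (a + b) n = a n + b n. Proof. by []. Qed.
Lemma fps_coefN a n : (- a) n = - a n. Proof. by []. Qed.
Lemma fps_coefM a b n : (a * b) n = \sum_(i < n.+1) a i * b (n - i)%N.
Proof. by []. Qed.
Lemma fps_coefXM a n : ((fps_X : fps K) * a) n = if n is m.+1 then a m else 0.
Proof.
rewrite fps_coefM; case: n => [|n].
  by rewrite big_ord_recl big_ord0 /fps_X mul0r addr0.
rewrite big_ord_recl big_ord_recl big1 ?addr0 => [|i _]; last first.
  by rewrite /fps_X mul0r.
by rewrite /fps_X mul0r mul1r add0r/= subSS subn0.
Qed.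

Lemma fps_powE a k : fps_pow a k = a ^+ k.
Proof. by elim: k => // k IHk; rewrite exprS -IHk. Qed.

Lemma fps_derivM a b : fps_deriv (a * b) = fps_deriv a * b + a * fps_deriv b.
Proof.
apply/funext => n; rewrite fps_coefD /fps_deriv.
(* Coefficient n of a derivative looks at coefficient n + 1, hence the truncation at [n.+2]. *)
pose P (c : fps K) : {poly K} := \poly_(i < n.+2) c i.
have PE (c : fps K) i : (i < n.+2)%N -> (P c)`_i = c i by move=> iN; rewrite coef_poly iN.
rewrite [(a * b) _](@fps_mul_poly _ n.+2)//.
rewrite -[X in X * _]/(n.+1%:R) mulr_natl -coef_deriv derivM coefD !coefM.
congr (_ + _); apply: eq_bigr => i _; have iN := ltn_ord i.
  by rewrite coef_deriv !PE ?mulr_natl// !ltnS (leq_trans (leq_subr _ _))// leqW.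
rewrite coef_deriv !PE ?mulr_natl//; last exact: leqW.
by rewrite !ltnS leq_subr.
Qed.

Lemma fps_coefMn a k n : (a *+ k) n = a n *+ k.
Proof. by elim: k => // k IHk; rewrite !mulrSr fps_coefD IHk. Qed.

Lemma fps_derivX a k : fps_deriv (a ^+ k.+1) = (fps_deriv a * a ^+ k) *+ k.+1.
Proof.
elim: k => [|k IHk]; first by rewrite expr0 mulr1.
by rewrite exprS fps_derivM IHk [RHS]mulrS mulrnAr mulrCA -exprS.
Qed.

End FpsTheory.

(** * Exponentials and linear differential equations *)

Section FpsExp.
Variable K : numFieldType.
Implicit Types a b c h u v w : fps K.

Lemma fps_deriv_int a : fps_deriv (fps_int a) = a.
Proof. by apply/funext => n; rewrite /fps_deriv/= mulrCA mulfV ?mulr1// pnatr_eq0. Qed.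

Lemma fps_deriv_exp h : h 0%N = 0 ->
  fps_deriv (fps_exp h) = fps_deriv h * fps_exp h.
Proof.
move=> h0; apply/funext => n; rewrite fps_coefM.
(* By [fps_expE] the coefficients of all indices n - i may be summed over the same range k < n + 1,
   so that the two sums can be exchanged. *)
under eq_bigr => i _.
  rewrite -(@fps_expE _ h (n - i) n.+1)// ?ltnS ?leq_subr// mulr_sumr.
  over.
rewrite exchange_big/= /fps_deriv {1}/fps_exp big_ord_recl/=.
(* The term k = 0 is the coefficient of x^(n+1) in the constant series 1. *)
rewrite [X in _ * (X + _)](_ : _ = 0) ?add0r ?mulr_sumr; last first.
  by rewrite /fps_pow/= /fps_one mul0r.
apply: eq_bigr => k _; rewrite mulrA fps_powE /bump add1n
  -[X in X / _]/(fps_deriv (h * h ^+ k) n) -exprS.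
rewrite fps_derivX fps_coefMn fps_coefM factS natrM.
rewrite -[_ *+ k.+1]mulr_natr invfM mulrA mulfK ?pnatr_eq0// mulr_suml.
by apply: eq_bigr => i _; rewrite mulrA.
Qed.

(** Comparing coefficients of x^n, the equation determines coefficient n + 1 from the earlier ones,
    as n + 1 is invertible in characteristic 0. *)
Lemma fps_ode_unique w u v : fps_deriv u = w * u -> fps_deriv v = w * v ->
  u 0%N = v 0%N -> u = v.
Proof.
move=> du dv uv0; apply/funext; elim/ltn_ind => -[//|n] IHn.
apply: (@mulfI _ n.+1%:R); first by rewrite pnatr_eq0.
rewrite -[LHS]/(fps_deriv u n) -[RHS]/(fps_deriv v n) du dv !fps_coefM.
by apply: eq_bigr => i _; rewrite IHn// ltnS leq_subr.
Qed.

Lemma fps_mul_eq0l a b : b 0%N != 0 -> a * b = 0 -> a = 0.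
Proof.
move=> b0 ab0; apply/funext; elim/ltn_ind => n IHn.
apply: (mulIf b0); rewrite mul0r -[RHS](congr1 (@^~ n) ab0) fps_coefM.
by rewrite big_ord_recr/= subnn big1 ?add0r// => i _; rewrite IHn// mul0r.
Qed.

(** In (u - v)(u + v) = 0 the factor u + v has constant term 2 and can be cancelled. *)
Lemma fps_sqr_inj u v : u 0%N = 1 -> v 0%N = 1 -> u * u = v * v -> u = v.
Proof.
move=> u0 v0 uv; apply/eqP; rewrite -subr_eq0; apply/eqP.
apply: (@fps_mul_eq0l _ (u + v)); first by rewrite fps_coefD u0 v0 (pnatr_eq0 _ 2).
by rewrite mulrDr !mulrBl uv [v * u]mulrC addrC subrKA subrr.
Qed.

End FpsExp.

(** * Abel's identities and the logarithmic derivative of f^2 *)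

Section Abel.
Variable K : numFieldType.

(** This is, up to sign, an m-th finite difference of a polynomial of degree d < m. Pascal's rule
    takes one difference inside, which lowers the degree. *)
Lemma alternating_binomial_sum (d m : nat) (x : K) : (d < m)%N ->
  \sum_(k < m.+1) (-1) ^+ k * (x + k%:R) ^+ d *+ 'C(m, k) = 0.
Proof.
elim: m d x => // m IHm d x; rewrite ltnS => dm.
rewrite big_ord_recl bin0 [X in _ + X](_ : _ =
  \sum_(k < m.+1) (-1) ^+ k.+1 * (x + 1 + k%:R) ^+ d *+ 'C(m, k) +
  \sum_(k < m.+1) (-1) ^+ k.+1 * (x + k.+1%:R) ^+ d *+ 'C(m, k.+1)); last first.
  rewrite -big_split/=; apply: eq_bigr => k _; rewrite /bump add1n binS mulrnDr addrC.
  by rewrite -[k.+1%:R]nat1r addrA.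
rewrite addrCA [X in _ + X](_ : _ =
  \sum_(k < m.+1) (-1) ^+ k * (x + k%:R) ^+ d *+ 'C(m, k)); last first.
  by rewrite [RHS]big_ord_recl bin0 big_ord_recr/= bin_small// !mulr0n !addr0.
rewrite -big_split/=.
(* The summand now contains (x + k)^d - (x + k + 1)^d, whose binomial expansion has only powers of x
   + k below d. *)
under eq_bigr => k _.
  rewrite -mulrnDl exprS mulN1r mulNr addrC -mulrBr [x + 1]addrC -addrA.
  rewrite (exprDn 1) big_ord_recr/= subnn expr0 mul1r binn mulr1n opprD addrCA subrr addr0.
  over.
under eq_bigr => k _.
  rewrite mulrN mulr_sumr -sumrN -sumrMnl.
  under eq_bigr => i _ do rewrite expr1n mul1r mulrnAr -mulNrn -mulrnA mulnC mulrnA.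
  over.
rewrite exchange_big/= big1// => i _; rewrite sumrMnl.
under eq_bigr do rewrite mulNrn.
by rewrite sumrN IHm ?oppr0 ?mul0rn// (leq_trans (ltn_ord i)).
Qed.

Lemma bin_fact_inv (n k : nat) : (k <= n)%N ->
  'C(n, k)%:R / n`!%:R = k`!%:R^-1 * (n - k)`!%:R^-1 :> K.
Proof.
move=> kn; rewrite -(bin_fact kn) !natrM !invfM !mulrA mulfV ?mul1r//.
by rewrite pnatr_eq0 -lt0n bin_gt0.
Qed.

(** The series g of the theorem. It counts rooted labelled trees and satisfies g = x exp(g). *)
Definition tree_egf : fps K := egf (fun n => if n is m.+1 then (n ^ m)%N%:R else 0).

(** In closed form exp(y g) / (1 - g), where g is [tree_egf]. The case y = -1 will be f^2. Below,
    A_y stands for [abel_egf y]. *)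
Definition abel_egf (y : K) : fps K := egf (fun n => (y + n%:R) ^+ n).

(** Up to the factor 1/(m+1)!, this is the (m+1)-st finite difference of j^m at 0 without the term j
    = 0, and that term is nonzero only for m = 0. *)
Lemma tree_inversion m : \sum_(k < m.+1)
  (-1) ^+ (m - k) * k.+1%:R ^+ m / (k.+1`!%:R * (m - k)`!%:R) = (m == 0)%:R :> K.
Proof.
have : \sum_(k < m.+2) (-1) ^+ k * (0 + k%:R : K) ^+ m *+ 'C(m.+1, k) = 0.
  exact: alternating_binomial_sum.
case: m => [|m].
  by rewrite big_ord1 subnn !expr0 fact0 factS fact0 muln1 !mulr1 divr1.
rewrite big_ord_recl/= add0r expr0n/= mulr0 mul0rn add0r => /(congr1 (fun x =>
  (-1) ^+ m.+2 * x / m.+2`!%:R)); rewrite mulr0 mul0r mulr_sumr mulr_suml => H; apply: etrans H.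
apply: eq_bigr => k _; rewrite /bump add1n add0r -[in RHS]mulr_natr !mulrA -[RHS]mulrA.
have km : (k <= m.+1)%N by rewrite -ltnS.
rewrite (@bin_fact_inv m.+2 k.+1)// subSS invfM -exprD.
suff -> : (-1) ^+ (m.+1 - k) = (-1) ^+ (m.+2 + k.+1) :> K by [].
rewrite -signr_odd -[RHS]signr_odd oddD oddB//; congr (_ ^+ nat_of_bool _).
by rewrite /=; case: (odd m); case: (odd k).
Qed.

(* Abel's identity \sum_(k >= 1) 'C(n, k) k^(k-1) (y + n - k)^(n-k) = n (y + n)^(n-1). *)
Lemma tree_abel y : tree_egf * abel_egf y = fps_X * abel_egf (y + 1).
Proof.
apply/funext => n; rewrite fps_coefXM fps_coefM big_ord_recl.
rewrite {1}/tree_egf /egf mul0r mul0r add0r; case: n => [|n]; first by rewrite big_ord0.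
(* With z = y + n + 1, the k-th summand contains (z - (k+1))^(n-k). After expansion in powers of z,
   the coefficient of z^(n-m) is a multiple of the sum in [tree_inversion], so only z^n survives. *)
rewrite /abel_egf /egf -addrA nat1r; set z := y + _.
pose F m k := z ^+ (n - m) / (n - m)`!%:R *
  ((-1) ^+ (m - k) * k.+1%:R ^+ m / (k.+1`!%:R * (m - k)`!%:R)).
transitivity (\sum_(k < n.+1) \sum_(m < n.+1 | (k <= m)%N) F m k).
  apply: eq_bigr => k _; have kn : (k <= n)%N by rewrite -ltnS.
  rewrite -(big_geq_mkord k n.+1 xpredT (F^~ k)) -{1}[nat_of_ord k]add0n big_addn big_mkord.
  rewrite lift0 subSS; have -> : y + (n - k)%:R = z - k.+1%:R.
    by rewrite /z -addrA; congr (_ + _); rewrite -natrB ?subSS.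
  rewrite subSn// exprBn mulr_suml mulr_sumr; apply: eq_bigr => i _.
  rewrite /F addnK [(i + k)%N]addnC subnDA -mulr_natr -!mulrA bin_fact_inv -1?ltnS//.
  rewrite /tree_egf /egf/= natrX exprD invfM; ring.
rewrite (exchange_big_dep xpredT)//=.
transitivity (\sum_(m < n.+1) z ^+ (n - m) / (n - m)`!%:R * (m == 0 :> nat)%:R).
  apply: eq_bigr => m _; rewrite -tree_inversion mulr_sumr.
  by rewrite (big_ord_widen n.+1 (F m)).
rewrite big_ord_recl big1 ?addr0 ?mulr1 ?subn0// => i _.
by rewrite mulr0.
Qed.

Lemma natr_div_fact (x : K) n : n.+1%:R * (x / n.+1`!%:R) = x / n`!%:R.
Proof. by rewrite factS natrM invfM mulrCA mulVKf ?pnatr_eq0. Qed.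

Lemma fps_deriv_tree : fps_deriv tree_egf = abel_egf 1.
Proof.
by apply/funext => n; rewrite /fps_deriv /tree_egf /egf natr_div_fact natrX -nat1r.
Qed.

Lemma fps_X_abel1 : fps_X * abel_egf 1 = abel_egf 0 - 1.
Proof.
apply/funext => -[|n]; rewrite fps_coefXM fps_coefD fps_coefN fps_coef1 /abel_egf /egf.
  by rewrite expr0 fact0 divr1 subrr.
by rewrite subr0 add0r exprS -mulrA natr_div_fact nat1r.
Qed.

Lemma fps_deriv_abelN1 : fps_deriv (abel_egf (-1)) = fps_X * fps_deriv (abel_egf 0).
Proof.
apply/funext => n; rewrite fps_coefXM /fps_deriv /abel_egf /egf natr_div_fact.
have -> : -1 + n.+1%:R = n%:R :> K by rewrite -natr1 addrC addrK.
by case: n => [|n]; rewrite exprS ?mul0r// add0r -mulrA.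
Qed.

(** Differentiate (1 - g) A_0 = 1 and multiply the result by A_0. *)
Lemma fps_deriv_abel0 :
  fps_deriv (abel_egf 0) = abel_egf 1 * (abel_egf 0 * abel_egf 0).
Proof.
have t0 : tree_egf * abel_egf 0 = abel_egf 0 - 1 by rewrite tree_abel add0r fps_X_abel1.
have dN1 (a : fps K) : fps_deriv (a - 1) = fps_deriv a.
  by apply/funext => n; rewrite /fps_deriv fps_coefD fps_coefN fps_coef1 subr0.
have := congr1 (@fps_deriv K) t0; rewrite fps_derivM fps_deriv_tree dN1.
set B := abel_egf 0 in t0 *; move=> dB.
have -> : fps_deriv B = (B - tree_egf * B) * fps_deriv B by rewrite t0; ring.
have -> : (B - tree_egf * B) * fps_deriv B =
  B * (fps_deriv B - tree_egf * fps_deriv B) by ring.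
by rewrite -{1}dB; ring.
Qed.

(** With u the exponential on the right and w = x (g')^2 / 2, both f^2 and u^2 solve v' = 2 w v with
    constant term 1. Hence f^2 = u^2, and f = u by [fps_sqr_inj]. *)
Lemma fps_exp_tree (f : fps K) : f 0%N = 1 -> f * f = abel_egf (-1) ->
  f = fps_exp (fps_int
        (fps_scale 2^-1 (fps_mul fps_X (fps_pow (fps_deriv tree_egf) 2)))).
Proof.
move=> f0 fE; rewrite fps_powE fps_deriv_tree; set w := fps_scale _ _.
have ww : w + w = fps_X * (abel_egf 1) ^+ 2.
  by apply/funext => n; rewrite fps_coefD /w /fps_scale -mulrDl -[2^-1]mul1r -splitr mul1r.
set u := fps_exp _.
have u0 : u 0%N = 1 by rewrite /u /fps_exp big_ord1 /fps_pow/= /fps_one divr1.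
have du : fps_deriv u = w * u by rewrite fps_deriv_exp// fps_deriv_int.
apply: fps_sqr_inj => //; apply: (@fps_ode_unique _ (w + w)).
- rewrite fE ww fps_deriv_abelN1 fps_deriv_abel0.
  have := tree_abel (-1); rewrite addNr => t1; have := tree_abel 0; rewrite add0r => t0.
  (* Two instances of [tree_abel] are used: x A_0 = g A_(-1), and then g A_0 = x A_1. *)
  transitivity (abel_egf 1 * (fps_X * abel_egf 0) * abel_egf 0); first by ring.
  rewrite -t1; transitivity (abel_egf 1 * (tree_egf * abel_egf 0) * abel_egf (-1)).
    by ring.
  by rewrite t0; ring.
- by rewrite fps_derivM du; ring.
- by rewrite !fps_coefM !big_ord1 f0 u0.
Qed.

End Abel.

(** * The inequalities of the parking polytope *)

Section Rado.
Variable R : realFieldType.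
Implicit Types (c y u v x : seq R) (C : seq R -> Prop).

Definition mix (l : R) u v := [seq l * p.1 + (1 - l) * p.2 | p <- zip u v].

Definition mix_closed n C := forall (l : R) u v, size u = n -> size v = n ->
  0 <= l <= 1 -> C u -> C v -> C (mix l u v).

(** With p a permutation of c, these x are the generators in Rado's theorem: some entries of p are
    replaced by 0. *)
Definition zeroed x p := all2 (fun a b : R => (a == 0) || (a == b)) x p.

(** For decreasing c the bound is the sum of the [size s] largest entries of c; ranging over all
    subsequences avoids sorting y. *)
Definition weakly_majorized y c := forall s, subseq s y ->
  \sum_(a <- s) a <= \sum_(a <- take (size s) c) a.

Lemma mix_same l x : mix l x x = x.
Proof. by elim: x => //= a x; rewrite /mix/= => ->; congr (_ :: _); ring. Qed.

Lemma mix_cons l a b u v : mix l (a :: u) (b :: v) = l * a + (1 - l) * b :: mix l u v.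
Proof. by []. Qed.

Lemma mix_cat l u1 u2 v1 v2 : size u1 = size v1 ->
  mix l (u1 ++ u2) (v1 ++ v2) = mix l u1 v1 ++ mix l u2 v2.
Proof. by move=> uv; rewrite /mix zip_cat// map_cat. Qed.

Lemma mix_closed_cons n C a : mix_closed n.+1 C -> mix_closed n (fun z => C (a :: z)).
Proof.
move=> cC l u v un vn l01 Cu Cv.
have -> : a :: mix l u v = mix l (a :: u) (a :: v) by rewrite /mix/=; congr (_ :: _); ring.
by apply: cC => //=; rewrite ?un ?vn.
Qed.

(** The two outcomes are the two cases of the induction in [rado_weak]. *)
Lemma split_at (a : R) c : (0 < size c)%N -> a <= head 0 c ->
  (exists c1 b, c = rcons c1 b /\ a <= b) \/
  (exists c1 b d c2, c = c1 ++ b :: d :: c2 /\ d < a <= b).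
Proof.
elim: c => // b c IHc _ /= ab; case: c IHc => [|d c] IHc.
  by left; exists [::], b.
have [ad|da] := leP a d; last by right; exists [::], b, d, c; rewrite da ab.
have [[c1 [e [-> ae]]]|[c1 [e [f [c2 [-> afe]]]]]] := IHc isT ad.
  by left; exists (b :: c1), e.
by right; exists (b :: c1), e, f, c2.
Qed.

Lemma zeroed_cons a b x p :
  zeroed (a :: x) (b :: p) = ((a == 0) || (a == b)) && zeroed x p.
Proof. by []. Qed.

Lemma zeroed_cat x1 x2 p1 p2 : size x1 = size p1 ->
  zeroed (x1 ++ x2) (p1 ++ p2) = zeroed x1 p1 && zeroed x2 p2.
Proof.
by elim: x1 p1 => [|a x1 IH] [|b p1]//= [] /IH; rewrite /zeroed/= -andbA => ->.
Qed.

Lemma zeroed_size x p : zeroed x p -> size x = size p.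
Proof. by rewrite /zeroed all2E => /andP[/eqP]. Qed.

Lemma zeroed_perm_split x p m : zeroed x p -> m \in p ->
  exists x1 x2 p1 p2 e, [/\ x = x1 ++ e :: x2, p = p1 ++ m :: p2, (e == 0) || (e == m),
    size x1 = size p1 & zeroed x1 p1 && zeroed x2 p2].
Proof.
move=> + /splitPr pm; case: pm => p1 p2 xp.
have sx := zeroed_size xp.
rewrite -[x](cat_take_drop (size p1)) in xp *.
have st : size (take (size p1) x) = size p1.
  by rewrite size_takel// sx size_cat leq_addr.
have := congr1 size (cat_take_drop (size p1) x); rewrite sx !size_cat st => /addnI.
case: (drop _ x) xp => // e x2 xp _.
move: xp; rewrite zeroed_cat// => /andP[h1 /= /andP[em h2]].
by exists (take (size p1) x), x2, p1, p2, e; rewrite h1.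
Qed.

(** This undoes the merging of a and b into m in [rado_weak], with a put in the position of y_1. *)
Lemma perm_insert2 (a b m : R) p1 p2 c1 c2 : perm_eq (p1 ++ m :: p2) (c1 ++ m :: c2) ->
  perm_eq (a :: p1 ++ b :: p2) (c1 ++ a :: b :: c2).
Proof.
move=> /permP pc; apply/permP => q; have := pc q; rewrite /= !count_cat/=.
by rewrite !(addnCA _ (q m)) => /addnI h; rewrite !(addnCA _ (q b)) h !(addnCA _ (q a)).
Qed.

(* Induction on n, removing y_1. If c_k >= y_1 >= c_(k+1), the pair (y_1, m) with
   m = c_k + c_(k+1) - y_1 is a convex combination of (c_k, c_(k+1)) and (c_(k+1), c_k),
   and the rest of y is weakly majorized by c with c_k, c_(k+1) replaced by m. The convex
   hull is encoded by quantifying over all convex C that contain the generators. *)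
Lemma rado_weak n c y C : size c = n -> size y = n ->
  sorted >=%R c -> all (>= 0) c -> all (>= 0) y -> weakly_majorized y c ->
  mix_closed n C -> (forall p x, perm_eq p c -> zeroed x p -> C x) -> C y.
Proof.
elim: n c y C => [|n IHn] c y C.
  by move=> /size0nil-> /size0nil-> _ _ _ _ _ H; exact: (H [::]).
case: y => // y1 y cn [yn] cs c0 /= /andP[y10 y0] yc cC Cc.
have yhead : y1 <= head 0 c.
  have := yc [:: y1]; rewrite big_seq1/= eqxx sub0seq => /(_ isT).
  by case: (c) cn => //= a c' _; rewrite take0 big_seq1.
have /split_at/(_ yhead) : (0 < size c)%N by rewrite cn.
move=> [[c1 [b [cE y1b]]]|[c1 [a [b [c2 [cE /andP[by1 y1a]]]]]]].
  (* If y_1 is at most the last entry b, drop b from c. Then y_1 lies between 0 and b, and both are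
     admissible values since entries may be zeroed. The weight y_1 / b makes b = 0 a separate
     case. *)
  subst c; rewrite size_rcons in cn; case: cn => cn.
  move: c0; rewrite all_rcons => /andP[b0 c0].
  apply: (IHn c1 y (fun z => C (y1 :: z))) => //.
  - by move: cs; rewrite -cats1 => /cat_sorted2[].
  - move=> s sy; have := yc s (subseq_trans sy (subseq_cons _ _)).
    by rewrite -cats1 takel_cat// cn -yn size_subseq.
  - exact: mix_closed_cons.
  move=> p x pc xp.
  have [bz|bnz] := eqVneq b 0.
    have -> : y1 = 0 by apply/le_anti; rewrite y10 -bz y1b.
    apply: (Cc (b :: p)); last by rewrite /zeroed/= eqxx.
    by rewrite perm_sym perm_rcons perm_cons perm_sym.
  have bgt : 0 < b by rewrite lt_def bnz.
  have -> : y1 :: x = mix (y1 / b) (b :: x) (0 :: x).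
    by rewrite /mix/= -/(mix _ x x) mix_same; congr (_ :: _); field.
  have sx : size x = n.
    by rewrite (zeroed_size xp) (perm_size pc).
  apply: cC; rewrite /= ?sx//.
  - by rewrite divr_ge0//= ler_pdivrMr// mul1r.
  - apply: (Cc (b :: p)); last by rewrite /zeroed/= eqxx orbT.
    by rewrite perm_sym perm_rcons perm_cons perm_sym.
  - apply: (Cc (b :: p)); last by rewrite /zeroed/= eqxx.
    by rewrite perm_sym perm_rcons perm_cons perm_sym.
subst c; pose m := a + b - y1.
move: cn; rewrite size_cat/= !addnS => -[cn].
apply: (IHn (c1 ++ m :: c2) y (fun z => C (y1 :: z))) => //.
- by rewrite size_cat/= addnS.
- have ge_trans : transitive (>=%R : rel R) by move=> ? ? ? /[swap]; exact: le_trans.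
  move: cs; rewrite !(sorted_pairwise ge_trans) !pairwise_cat/=.
  rewrite !allrel_consr => /and4P[/and3P[c1a c1b ->] -> /andP[ab ac2] /andP[bc2 ->]].
  rewrite !andbT; apply/andP; split.
    by apply: sub_all c1a => z /= az; rewrite (le_trans _ az)// /m; lra.
  by apply: sub_all bc2 => z /= bz; rewrite (le_trans bz)// /m; lra.
- move: c0; rewrite !all_cat/= => /and4P[-> a0 b0 ->]; rewrite andbT/= /m; lra.
(* Prefixes of length at most [size c1] agree in both lists. A longer one contains m, and the
   hypothesis on y_1 :: s gives the bound because y_1 + m = a + b. *)
- move=> s sy; case: (leqP (size s) (size c1)) => sc.
    have := yc s (subseq_trans sy (subseq_cons _ _)).
    by rewrite !takel_cat.
  have := yc (y1 :: s); rewrite /= eqxx => /(_ sy); rewrite big_cons.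
  have tk k v : take (size c1 + k) (c1 ++ v) = c1 ++ take k v.
    by rewrite take_cat ltnNge leq_addr addKn.
  rewrite -[size s](subnKC (ltnW sc)).
  case: (size s - size c1)%N (subn_gt0 (size c1) (size s)) => [|j _].
    by rewrite ltnn sc.
  by rewrite -addnS !tk/= !big_cat/= !big_cons /m; lra.
- exact: mix_closed_cons.
move=> p x pc xp.
have [|x1 [x2 [p1 [p2 [e [xE pE em sxp xp']]]]]] := zeroed_perm_split (m := m) xp.
  by rewrite (perm_mem pc) mem_cat mem_head orbT.
(* The weight l satisfies y_1 = l a + (1 - l) b, whence m = l b + (1 - l) a. If m was zeroed, both
   of its partners [e1] and [e2] are zeroed. *)
subst x p; pose l := (y1 - b) / (a - b).
have ab : a - b != 0 by rewrite subr_eq0 gt_eqF// (lt_le_trans by1).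
pose e1 := if e == 0 then 0 else b; pose e2 := if e == 0 then 0 else a.
have -> : y1 :: x1 ++ e :: x2 = mix l (a :: x1 ++ e1 :: x2) (b :: x1 ++ e2 :: x2).
  rewrite mix_cons mix_cat// mix_cons !mix_same /l; congr (_ :: _ ++ _ :: _); first by field.
  rewrite /e1 /e2; case: eqP em => [->|_ /eqP->]; first by rewrite !mulr0 addr0.
  by rewrite /m; field.
have sx : (size x1 + size x2).+1 = n.
  rewrite -cn; have := perm_size pc; rewrite !size_cat/= !addnS sxp => <-.
  by move: xp' => /andP[_ /zeroed_size->].
apply: cC.
- by rewrite /= size_cat/= addnS sx.
- by rewrite /= size_cat/= addnS sx.
- rewrite /l; apply/andP; split; first by rewrite divr_ge0//; lra.
  by rewrite ler_pdivrMr; lra.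
- apply: (Cc (a :: p1 ++ b :: p2)); first exact: perm_insert2 pc.
  rewrite zeroed_cons eqxx orbT zeroed_cat// zeroed_cons [andb true _]/= andbCA xp' andbT.
  by rewrite /e1; case: ifP; rewrite eqxx ?orbT.
- apply: (Cc (b :: p1 ++ a :: p2)).
    apply: perm_trans (perm_insert2 b a pc) _; rewrite perm_cat2l.
    by apply/permP => q /=; rewrite addnCA.
  rewrite zeroed_cons eqxx orbT zeroed_cat// zeroed_cons [andb true _]/= andbCA xp' andbT.
  by rewrite /e2; case: ifP; rewrite eqxx ?orbT.
Qed.

End Rado.

Lemma map_tnth_enum_setT (T : Type) n (t : n.-tuple T) :
  [seq tnth t i | i <- enum [set: 'I_n]] = t.
Proof. by rewrite -[RHS]map_tnth_enum; congr map; rewrite enum_setT enumT. Qed.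

(** * Parking functions and their inequalities *)

Section ParkingInequalities.
Variable R : realFieldType.

(* The closed form of (n-1) + ... + (n-k), for k <= n. *)
Definition parking_rank (n k : nat) : R := k%:R * n%:R - k%:R * (k%:R + 1) / 2.

(** Sequences and subsequences, rather than vectors and index sets, let this apply to the
    restriction of a tuple to any set of indices. *)
Definition parking_ineq (x : seq R) := (forall a, a \in x -> 1 <= a) /\
  forall s, subseq s x -> \sum_(a <- s) (a - 1) <= parking_rank (size x) (size s).

Lemma parking_ineq_enum n (f : 'I_n -> R) (S : {set 'I_n}) :
  parking_ineq [seq f i | i <- enum S] <-> (forall i, i \in S -> 1 <= f i) /\
  forall U : {set 'I_n}, U \subset S ->
    \sum_(i in U) (f i - 1) <= parking_rank #|S| #|U|.
Proof.
rewrite /parking_ineq size_map -cardE; split=> -[h1 h2]; split.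
- by move=> i iS; apply/h1/map_f; rewrite mem_enum.
- move=> U US; have -> : #|U| = size [seq f i | i <- enum U] by rewrite size_map -cardE.
  rewrite -big_enum/= -(big_map f xpredT (fun a => a - 1)); apply: h2; apply: map_subseq.
  suff -> : enum U = [seq i <- enum S | i \in U] by exact: filter_subseq.
  rewrite /enum_mem -filter_predI; apply: eq_filter => i /=.
  by rewrite andb_idr// => /(fintype.subsetP US).
- by move=> _ /mapP[i iS ->]; apply: h1; rewrite -mem_enum.
- move=> _ /subseqP[m _ ->]; rewrite -map_mask big_map size_map.
  have us : uniq (mask m (enum S)) by by rewrite mask_uniq ?enum_uniq.
  rewrite big_uniq// -(card_uniqP us).
  pose U : {set 'I_n} := finset (mem (mask m (enum S))).
  rewrite -(cardsE (mem (mask m (enum S)))) -/U (eq_bigl (fun i => i \in U)) => [|i].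
    by apply: h2; apply/fintype.subsetP => i; rewrite finset.in_set => /mem_mask; rewrite mem_enum.
  by rewrite finset.in_set.
Qed.

Lemma parking_ineq_tuple n (t : n.-tuple R) :
  parking_ineq t <-> (forall i, 1 <= tnth t i) /\
  forall U : {set 'I_n}, \sum_(i in U) (tnth t i - 1) <= parking_rank n #|U|.
Proof.
rewrite -[X in parking_ineq X]map_tnth_enum_setT; split.
  move=> /parking_ineq_enum[h1 h2]; split=> [i|U]; first exact: h1.
  by have := h2 U; rewrite cardsT card_ord; apply; exact: finset.subsetT.
move=> [h1 h2]; apply/parking_ineq_enum; rewrite cardsT card_ord.
by split=> [i _|U _]; [exact: h1|exact: h2].
Qed.

(** For c = (n-1, ..., 0) the bound of [weakly_majorized] is thus that of [parking_ineq]. *)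
Lemma parking_rank_take n k : (k <= n)%N ->
  \sum_(a <- take k [seq (n - i.+1)%:R | i <- iota 0 n]) a = parking_rank n k.
Proof.
move=> kn; rewrite -map_take big_map take_iota (minn_idPl kn).
have -> : iota 0 k = index_iota 0 k by rewrite /index_iota subn0.
elim: k kn => [|k IHk] kn; first by rewrite big_geq// /parking_rank; lra.
rewrite big_nat_recr//= IHk; last exact: ltnW.
by rewrite natrB// /parking_rank -[k.+1%:R]natr1; field.
Qed.

(** Entry i of s is followed by size s - i - 1 others, so it occurs in b at a position at most i +
    (size b - size s). *)
Lemma nth_subseq_bound (b s : seq nat) d :
  (forall i, (i < size b)%N -> (nth 0 b i <= i + d)%N) -> subseq s b ->
  forall i, (i < size s)%N -> (nth 0 s i <= i + d + (size b - size s))%N.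
Proof.
elim: b s d => [|b0 b IHb] s d bd; first by rewrite subseq0 => /eqP->.
have bd' i : (i < size b)%N -> (nth 0 b i <= i + d.+1)%N.
  by move=> ib; have := bd i.+1 ib; rewrite /= addSnnS.
case: s => // s0 s /=; case: eqP => [->|_] sb [|i] /= ilt.
- by rewrite (leq_trans (bd 0%N isT))// leq_addr.
- by rewrite subSS addSnnS; exact: IHb bd' sb _ ilt.
- have := IHb _ _ bd' sb 0%N isT; have := size_subseq sb; rewrite /=; clear; lia.
- have := IHb _ _ bd' sb i.+1 ilt; have := size_subseq sb; rewrite /=; clear; lia.
Qed.

(** Sort the k chosen values. By [nth_subseq_bound] entry i, counted from 0, is at most i + 1 + (n -
    k), and the numbers i + (n - k) for i < k add up to [parking_rank n k]. *)
Lemma parking_function_ineq n (a : n.-tuple nat) : is_parking_function a ->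
  parking_ineq [seq k%:R | k <- a].
Proof.
move=> [a1 asort]; split.
  by move=> _ /mapP[k /tnthP[i ->] ->]; rewrite ler1n; case/andP: (a1 i).
move=> _ /subseqP[m _ ->]; rewrite -map_mask !size_map big_map.
have /(subseq_sort leq_total leq_trans) := mask_subseq m a.
move: (mask m a) => s sa.
have -> : \sum_(j <- s) (j%:R - 1 : R) = \sum_(j <- sort leq s) (j%:R - 1).
  by apply: perm_big; rewrite perm_sym perm_sort.
have asize : size (sort leq a) = n by rewrite size_sort size_tuple.
rewrite size_tuple -(size_sort leq s); move: sa; move: (sort leq s) => {}s sa.
have := nth_subseq_bound (d := 1) _ sa; rewrite asize => s1.
have sn : (size s <= n)%N by rewrite -asize size_subseq.
rewrite (big_nth 0%N) big_mkord.
apply: (@le_trans _ _ (\sum_(i < size s) (i%:R + (n%:R - (size s)%:R)))).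
  apply: ler_sum => i _; rewrite lerBlDr -natrB// -natrD natr1 ler_nat.
  rewrite -addSn -addn1; apply: s1 => // j jn; rewrite addn1.
  exact: (asort (Ordinal jn)).
rewrite big_split/= sumr_const card_ord -natr_sum.
suff -> : (\sum_(i < size s) i)%N%:R = (size s)%:R * ((size s)%:R - 1) / 2 :> R.
  by rewrite /parking_rank -[_ *+ size s]mulr_natr; lra.
by elim: (size s) => [|k IH]; rewrite ?big_ord0 ?mul0r//
  big_ord_recr natrD IH -[k.+1%:R]natr1; field.
Qed.

(** Adding 1 to p gives a permutation of 1, ..., n. Zeroing an entry of p lowers the corresponding
    value to 1, which preserves the parking condition. *)
Lemma zeroed_parking n (p x : seq R) :
  perm_eq p [seq (n - i.+1)%:R | i <- iota 0 n] -> zeroed x p ->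
  exists2 a : n.-tuple nat, is_parking_function a & x = [seq k%:R - 1 | k <- a].
Proof.
set c := map _ _ => /(perm_iotaP 0)[Is]; have sc : size c = n by rewrite size_map size_iota.
rewrite sc => IsP -> xp.
have sI : size Is = n by rewrite (perm_size IsP) size_iota.
have sx : size x = n by rewrite (zeroed_size xp) size_map.
have In j : (j < n)%N -> (nth 0 Is j < n)%N.
  move=> jn; have : nth 0%N Is j \in Is by rewrite mem_nth// sI.
  by rewrite (perm_mem IsP) mem_iota.
have xI j : (j < n)%N -> nth 0 x j != 0 -> nth 0 x j = (n - nth 0%N Is j)%:R - 1.
  move=> jn /negPf x0; move: xp; rewrite /zeroed all2E size_map sx sI eqxx/=.
  move=> /(all_nthP (0, 0))/(_ j); rewrite size_zip size_map sx sI minnn => /(_ jn).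
  rewrite nth_zip ?size_map ?sx ?sI//= x0/= (nth_map 0%N) ?sI// => /eqP->.
  rewrite (nth_map 0%N) ?size_iota ?In// nth_iota ?In// add0n.
  by rewrite subnS -subn1 natrB// subn_gt0 In.
have [a aE] : exists a : n.-tuple nat, forall j,
    tnth a j = (if nth 0%R x j == 0%R then 1 else n - nth 0 Is j)%N.
  by exists [tuple (if nth 0%R x j == 0%R then 1 else n - nth 0 Is j)%N | j < n] => j;
    rewrite tnth_mktuple.
exists a; last first.
  apply: (@eq_from_nth _ 0); rewrite sx ?size_map ?size_tuple// => j jn.
  rewrite (nth_map 0%N) ?size_tuple// -[j]/(nat_of_ord (Ordinal jn)) -tnth_nth aE/=.
  by case: eqP => [->|/eqP/xI->//]; rewrite ?subrr.
split=> [i|i].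
  rewrite aE; have := In _ (ltn_ord i); have := ltn_ord i.
  by case: ifP; lia.
(* It suffices that at least i + 1 values are at most i + 1. Among the numbers n - v with v in [Is]
   there are exactly i + 1 such, and replacing values by 1 only adds to them. *)
apply: (Order.POrderTheory.nth_count_le 0%N); first exact: sort_le_sorted.
rewrite count_sort; apply: (@leq_trans (count (fun v => n - v <= i.+1)%N Is)).
  have /permP -> := IsP.
  have ltin := ltn_ord i.
  rewrite -[X in iota _ X](subnK ltin) iotaD count_cat add0n -[(i < _)%N]/(i.+1 <= _)%N.
  suff -> : count (fun v => n - v <= i.+1)%N (iota (n - i.+1) i.+1) = i.+1 by exact: leq_addl.
  rewrite -[RHS](size_iota (n - i.+1)); apply/eqP; rewrite -all_count.
  by apply/allP => v; rewrite mem_iota; lia.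
have IsE : Is = [seq nth 0%N Is (j : 'I_n) | j <- enum 'I_n].
  by rewrite map_comp val_enum_ord -sI -/(mkseq _ _) mkseq_nth.
rewrite {1}IsE.
rewrite -[X in (_ <= count _ X)%N](map_tnth_enum a) !count_map; apply: sub_count => j /=.
by rewrite aE leEnat; case: ifP.
Qed.

End ParkingInequalities.

(** * The parking polytope as a polymatroid *)

Section ParkingPolytope.
Variable R : realType.
Local Open Scope classical_set_scope.

Lemma parking_ineq_row n (v : 'rV[R]_n) :
  parking_ineq [tuple v 0 i | i < n] <-> (forall i, 1 <= v 0 i) /\
  forall U : {set 'I_n}, \sum_(i in U) (v 0 i - 1) <= parking_rank R n #|U|.
Proof.
split=> [/parking_ineq_tuple[h1 h2]|[h1 h2]].
  split=> [i|U]; first by have := h1 i; rewrite tnth_mktuple.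
  by have := h2 U; under eq_bigr do rewrite tnth_mktuple.
apply/parking_ineq_tuple; split=> [i|U]; first by rewrite tnth_mktuple.
by under eq_bigr do rewrite tnth_mktuple.
Qed.

Lemma convex_parking_ineq n :
  convex_set ([set v | parking_ineq [tuple v 0 i | i < n]] : set 'rV[R]_n).
Proof.
move=> u v l; rewrite !inE => /parking_ineq_row[u1 u2] /parking_ineq_row[v1 v2].
suff : forall w : 'rV[R]_n, w = l%:num *: u + (1 - l%:num) *: v ->
  parking_ineq [tuple w 0 i | i < n] by exact.
have l0 : 0 <= l%:num by [].
have l1 : 0 <= 1 - l%:num by rewrite subr_ge0.
move=> w wE; have {}wE i : w 0 i - 1 =
    l%:num * (u 0 i - 1) + (1 - l%:num) * (v 0 i - 1).
  by rewrite wE !mxE; ring.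
apply/parking_ineq_row; split=> [i|U].
  by rewrite -subr_ge0 wE; apply: addr_ge0; apply: mulr_ge0; rewrite // subr_ge0.
under eq_bigr do rewrite wE.
set r := parking_rank R n #|U|; have -> : r = l%:num * r + (1 - l%:num) * r by ring.
by rewrite big_split/= -!mulr_sumr lerD// ler_wpM2l.
Qed.

(** The inequalities cut out a convex set that contains the parking functions. Conversely,
    [rado_weak] with c = (n-1, ..., 0) puts t into every convex set A containing them. *)
Lemma parking_polytopeE n (t : n.-tuple R) :
  parking_polytope R n (\row_i tnth t i) <-> parking_ineq t.
Proof.
split=> [h|[t1 t2] A [cA Apark]].
  have -> : t = [tuple (\row_i tnth t i) 0 i | i < n].
    by apply: eq_from_tnth => i; rewrite tnth_mktuple mxE.
  apply: (h [set v : 'rV[R]_n | parking_ineq [tuple v 0 i | i < n]]); split.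
    exact: convex_parking_ineq.
  move=> _ [a /= pa <-]; rewrite (_ : tval _ = [seq k%:R | k <- a]).
    exact: parking_function_ineq.
  rewrite -[in RHS](map_tnth_enum a) -map_comp; apply: eq_map => i /=.
  by rewrite mxE.
(* Rado's theorem concerns nonnegative vectors with zeroed entries, hence the shift of all
   coordinates by 1. *)
pose C (z : seq R) := A (\row_(i < n) (1 + nth 0 z i)).
have -> : \row_i tnth t i = \row_(i < n) (1 + nth 0 [seq a - 1 | a <- t] i).
  apply/rowP => i; rewrite !mxE (nth_map 0) ?size_tuple//.
  by rewrite (tnth_nth 0) subrKC.
apply: (@rado_weak R n [seq (n - i.+1)%:R | i <- iota 0 n] _ C).
- by rewrite size_map size_iota.
- by rewrite size_map size_tuple.
- rewrite (homo_sorted (e := ltn))//; last exact: iota_ltn_sorted.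
  by move=> i j /= ij; rewrite ler_nat leq_sub2l// ltnW.
- by rewrite all_map; apply/allP => i _ /=.
- by rewrite all_map; apply/allP => a /t1 /=; rewrite subr_ge0.
- move=> _ /subseqP[m _ ->]; rewrite -map_mask big_map size_map parking_rank_take.
    by rewrite -[X in parking_rank _ X](size_tuple t); apply: t2; exact: mask_subseq.
  by rewrite -[X in (_ <= X)%N](size_tuple t) size_subseq// mask_subseq.
- move=> l u v un vn /andP[l0 l1] Cu Cv; rewrite /C.
  have := cA (\row_(i < n) (1 + u`_i)) (\row_(i < n) (1 + v`_i)) (Itv01 l0 l1).
  rewrite !inE => /(_ Cu Cv); congr A; apply/rowP => i; rewrite /conv/= !mxE.
  rewrite /mix (nth_map (0, 0)) ?size_zip ?un ?vn ?minnn// nth_zip ?un ?vn//=.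
  by rewrite /unstable.onem; ring.
- move=> p x pc xp; rewrite /C.
  have [a pa ->] := zeroed_parking pc xp.
  apply: Apark; exists a => //; apply/rowP => i; rewrite !mxE (nth_map 0%N) ?size_tuple//.
  by rewrite subrKC -tnth_nth.
Qed.

End ParkingPolytope.

(** * Lebesgue measure on tuples *)

Section SeqMeasure.
Local Open Scope classical_set_scope.
Local Open Scope ring_scope.
Variable R : realType.
Local Notation mR := (measurableTypeR R).
Implicit Types A B : set (seq R).

(* Sets of sequences rather than of n-tuples, so that splitting a tuple along a mask
   needs no casts between lengths. *)
Definition tuples n A : set (n.-tuple mR) := [set t | A t].
Arguments tuples n A : clear implicits.
Definition seq_measurable A := forall n, measurable (tuples n A).
Definition seq_measure n A : \bar R := lebesgue_tuple n (tuples n A).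

Lemma measurable_preimage_cons n (E : set (n.+1.-tuple mR)) : measurable E ->
  measurable [set p : mR * n.-tuple mR | E [tuple of p.1 :: p.2]].
Proof.
by move=> mE; rewrite -[X in measurable X]setTI; apply: measurable_cons => //.
Qed.

Lemma seq_measurable_section A x : seq_measurable A ->
  seq_measurable [set s | A (x :: s)].
Proof.
move=> mA n; have := measurable_xsection x (measurable_preimage_cons (mA n.+1)).
by congr measurable; apply/seteqP; split=> t; rewrite /xsection/= inE.
Qed.

Lemma seq_measureS n A :
  seq_measure n.+1 A = (\int[lebesgue_measure]_x seq_measure n [set s | A (x :: s)])%E.
Proof.
rewrite /seq_measure/= /pushforward /product_measure1; apply: eq_integral => x _ /=.
by congr lebesgue_tuple; apply/seteqP; split=> t; rewrite /xsection/= inE.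
Qed.

Lemma measurable_seq_measure_section n A : seq_measurable A ->
  measurable_fun [set: mR] (fun x => seq_measure n [set s | A (x :: s)]).
Proof.
move=> mA; have := measurable_fun_xsection (lebesgue_tuple n)
  (measurable_preimage_cons (mA n.+1)).
congr measurable_fun; apply/funext => x /=.
by congr lebesgue_tuple; apply/seteqP; split=> t; rewrite /xsection/= inE.
Qed.

Lemma seq_measure0 A : seq_measure 0 A = `[< A [::] >]%:R%:E.
Proof.
by rewrite /seq_measure/= diracE; congr (_%:R%:E); apply/idP/asboolP; rewrite inE.
Qed.

(** Fubini, one coordinate at a time: the first coordinate enters only one of the two conditions,
    and the measure of the other leaves the integral. *)
Lemma seq_measure_mask (m : seq bool) A B : seq_measurable A -> seq_measurable B ->
  seq_measure (size m) [set s | A (mask m s) /\ B (mask (map negb m) s)] =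
  (seq_measure (count id m) A * seq_measure (count negb m) B)%E.
Proof.
elim: m A B => [|b m IHm] A B mA mB.
  by rewrite /= !seq_measure0/= asbool_and; case: asboolP; case: asboolP => _ _;
    rewrite ?mule1 ?mule0.
rewrite seq_measureS; case: b => /=; rewrite !add0n ?add1n.
  under eq_integral => x _.
    rewrite (IHm [set s | A (x :: s)] B (seq_measurable_section x mA) mB) muleC.
    over.
  rewrite ge0_integralZl//; first by rewrite seq_measureS muleC.
    exact: measurable_seq_measure_section.
under eq_integral => x _.
  rewrite (IHm A [set s | B (x :: s)] mA (seq_measurable_section x mB)).
  over.
rewrite ge0_integralZl//; first by rewrite seq_measureS.
exact: measurable_seq_measure_section.
Qed.

Lemma measurable_reflection (c : R) : measurable_fun [set: mR] (fun x : mR => c - x : mR).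
Proof. exact: (@measurable_funB _ _ R setT (cst c) id). Qed.

Lemma lebesgue_measure_reflection (c : R) (A : set mR) : measurable A ->
  pushforward lebesgue_measure (fun x : mR => c - x : mR) A = lebesgue_measure A.
Proof.
move=> mA; apply/esym.
apply: (@lebesgue_measure_unique R
  (measure_function_pushforward__canonical__measure_function_Measure lebesgue_measure
     (measurable_reflection c))) => // _ [[a b]] _ <-.
(* The generating interval []a, b]] pulls back to [[c - b, c - a[], of the same length. *)
rewrite /= /pushforward [X in _ = lebesgue_measure X](_ : _ = `[c - b, c - a[%classic).
  rewrite !lebesgue_measure_itv/= !lte_fin ltrD2l ltrN2.
  by case: ifP => // _; rewrite -!EFinB; congr EFin; ring.
apply/seteqP; split=> x; rewrite /= !in_itv/=; lra.
Qed.

Lemma ge0_integral_reflection (c : R) (f : mR -> \bar R) : measurable_fun [set: mR] f ->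
  (forall x, (0 <= f x)%E) ->
  (\int[lebesgue_measure]_x f (c - x : mR)%R = \int[lebesgue_measure]_x f x)%E.
Proof.
move=> mf f0; rewrite -[LHS](ge0_integral_pushforward (measurable_reflection c)
  lebesgue_measure (D := setT) (f := f))//.
apply: (@eq_measure_integral _ mR R setT lebesgue_measure
  (measure_function_pushforward__canonical__measure_function_Measure lebesgue_measure
     (measurable_reflection c))) => A mA _.
exact: lebesgue_measure_reflection.
Qed.

Lemma seq_measure_reflection n (c : R) A : seq_measurable A ->
  seq_measure n [set s | A [seq c - x | x <- s]] = seq_measure n A.
Proof.
elim: n A => [|n IHn] A mA; first by rewrite !seq_measure0.
rewrite !seq_measureS/=.
under eq_integral => x _.
  rewrite (IHn [set s | A (c - x :: s)] (seq_measurable_section _ mA)).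
  over.
rewrite (@ge0_integral_reflection c (fun x => seq_measure n [set s | A (x :: s)]))//.
exact: measurable_seq_measure_section.
Qed.

Lemma measurable_nth_tuple n i :
  measurable_fun [set: n.-tuple mR] (fun t => nth 0 t i : mR).
Proof.
have [ilt|ige] := ltnP i n.
  rewrite (_ : (fun _ => _) = (fun t => tnth t (Ordinal ilt))).
    exact: measurable_tnth.
  by apply/funext => t; rewrite (tnth_nth 0).
rewrite (_ : (fun _ => _) = cst (0 : mR)); first exact: measurable_cst.
by apply/funext => t; rewrite nth_default// size_tuple.
Qed.

Lemma measurable_linear_form k (w : 'I_k -> R) n :
  measurable_fun [set: n.-tuple mR] (fun t => \sum_(i < k) w i * nth 0 t i : R).
Proof.
apply: measurable_sum => i; apply: measurable_funM; first exact: measurable_cst.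
exact: measurable_nth_tuple.
Qed.

Lemma seq_measurable_hyperplane k (w : 'I_k -> R) (c : R) :
  seq_measurable [set s | \sum_(i < k) w i * nth 0 s i = c].
Proof.
move=> n; rewrite -[X in measurable X]setTI.
exact: (measurable_linear_form w) (measurable_set1 c).
Qed.

(** Fix the first coordinate x. If another weight is nonzero, every section is a hyperplane of lower
    dimension, hence null; otherwise every section is empty except at x = c / w_0. *)
Lemma seq_measure_hyperplane n (w : 'I_n -> R) (c : R) i0 : w i0 != 0 ->
  seq_measure n [set s | \sum_(i < n) w i * nth 0 s i = c] = 0%E.
Proof.
elim: n w c i0 => [|n IHn] w c i0 wi0; first by case: i0 wi0.
have sectionE x : [set s : seq R | \sum_(i < n.+1) w i * nth 0 (x :: s) i = c] =
    [set s | \sum_(i < n) w (lift ord0 i) * nth 0 s i = c - w ord0 * x].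
  apply/seteqP; split=> s; rewrite /= big_ord_recl/=; first by move=> <-; ring.
  by move=> ->; ring.
have mA := seq_measurable_hyperplane w c.
rewrite seq_measureS -(integral0 (@lebesgue_measure R) setT).
have [[j wj]|w0] := pselect (exists j, w (lift ord0 j) != 0).
  by apply: eq_integral => x _; rewrite [X in seq_measure _ X]sectionE (IHn _ _ j).
have w00 : w ord0 != 0.
  case: (unliftP ord0 i0) wi0 => [j ->|-> //] wj.
  by exfalso; apply: w0; exists j.
apply: ge0_ae_eq_integral => //.
- exact: measurable_seq_measure_section.
- exists [set c / w ord0]; split=> //; first exact: lebesgue_measure_set1.
  move=> x /= xc; apply: contrapT => xne; apply: xc => _.
  rewrite [X in seq_measure _ X](_ : _ = set0) ?[LHS]measure0//.
  apply/seteqP; split=> s //=; rewrite big_ord_recl/= big1 ?addr0 => [wx|j _].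
    by apply: xne; rewrite /= -wx mulrAC mulfV// mul1r.
  by have [->|wj] := eqVneq (w (lift ord0 j)) 0; rewrite ?mul0r//; case: w0; exists j.
Qed.

End SeqMeasure.
Arguments tuples {R} n A.

(** * The volume recursion *)

Section Partition.
Local Open Scope classical_set_scope.
Local Open Scope ring_scope.
Variable R : realType.
Local Notation mR := (measurableTypeR R).

Lemma measurable_forall d (T : measurableType d) (I : finType) (F : I -> set T) :
  (forall i, measurable (F i)) -> measurable [set t | forall i, F i t].
Proof.
move=> mF; rewrite (_ : [set t | _] = \bigcap_(i in [set: I]) F i).
  by apply: fin_bigcap_measurable.
by apply/seteqP; split=> t h i; [move=> _; exact: h|exact: h].
Qed.

Lemma measurable_parking_ineq d (T : measurableType d) n (f : 'I_n -> T -> mR)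
    (S : {set 'I_n}) : (forall i, measurable_fun setT (f i)) ->
  measurable [set t | @parking_ineq R [seq f i t | i <- enum S]].
Proof.
move=> mf; rewrite (_ : [set t | _] =
  [set t | forall i, i \in S -> 1 <= f i t] `&`
  [set t | forall U : {set 'I_n}, U \subset S ->
    \sum_(i in U) (f i t - 1) <= parking_rank R #|S| #|U|]); last first.
  by apply/seteqP; split=> t /=; rewrite parking_ineq_enum.
have mle (g : T -> R) c : measurable_fun setT g -> measurable [set t | g t <= c].
  move=> mg; rewrite (_ : [set t | _] = setT `&` g @^-1` `]-oo, c]).
    exact: mg.
  by apply/seteqP; split=> t /=; rewrite in_itv/=; tauto.
apply: measurableI.
  apply: (@measurable_forall _ _ _ (fun i => [set t | i \in S -> 1 <= f i t])) => i.
  have [iS|iS] := boolP (i \in S); last by rewrite (_ : [set t | _] = setT)//; apply/seteqP.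
  rewrite (_ : [set t | _] = [set t | 0 - (f i t : R) <= - 1]); last first.
    by apply/seteqP; split=> t /=; rewrite sub0r lerN2; [apply|].
  by apply: mle; apply: measurable_funB => //; exact: mf.
apply: (@measurable_forall _ _ _ (fun U : {set 'I_n} => [set t | U \subset S ->
    \sum_(i in U) (f i t - 1) <= parking_rank R #|S| #|U|])) => U.
have [US|US] := boolP (U \subset S); last by rewrite (_ : [set t | _] = setT)//; apply/seteqP.
rewrite (_ : [set t | _] = [set t | \sum_(i in U) ((f i t : R) - 1) <=
    parking_rank R #|S| #|U|]); last by apply/seteqP; split=> t /=; [apply|].
apply: mle; rewrite (_ : (fun t => _) = fun t => \sum_(i <- enum U) ((f i t : R) - 1)).
  by apply: measurable_sum => i; apply: measurable_funB => //; exact: mf.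
by apply/funext => t; rewrite big_enum.
Qed.

(** The reflection x -> n + 1 - x exchanges the endpoints of [1, n]. *)
Definition parking_cell n (S : {set 'I_n}) : set (n.-tuple mR) :=
  [set t | parking_ineq [seq n.+1%:R - tnth t i | i <- enum S] /\
           parking_ineq [seq tnth t i | i <- enum (~: S)]].

Definition excess n (t : n.-tuple R) (S : {set 'I_n}) : R :=
  \sum_(i in S) (tnth t i - 1) - parking_rank R n #|S|.

(** Comparing S with S \ U for U inside S gives the inequalities of the reflected part, and
    comparing S with its union with U for U outside S gives those of the other part. These special
    comparisons imply the one with an arbitrary T. *)
Lemma parking_cellP n (S : {set 'I_n}) (t : n.-tuple R) : parking_cell S t <->
  (forall i, 1 <= tnth t i <= n%:R) /\ forall T, excess t T <= excess t S.
Proof.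
have sumC (U : {set 'I_n}) : \sum_(i in U) (n.+1%:R - tnth t i - 1) =
    #|U|%:R * (n%:R - 1) - \sum_(i in U) (tnth t i - 1).
  rewrite mulr_natl -sumr_const -sumrB; apply: eq_bigr => i _.
  by rewrite -natr1; ring.
have Sn : (#|S| <= n)%N by rewrite -[X in (_ <= X)%N]card_ord max_card.
have Snr : #|S|%:R <= n%:R :> R by rewrite ler_nat.
have CS : #|~: S| = (n - #|S|)%N by rewrite cardsCs finset.setCK card_ord.
split.
  move=> [/parking_ineq_enum[S1 S2] /parking_ineq_enum[C1 C2]].
  split=> [i|T].
    (* One bound on coordinate i is the first half of [parking_ineq]; the other is the inequality
       for the singleton of i. *)
    have [iS|iS] := boolP (i \in S).
      have := S1 i iS; have := S2 (finset.set1 i); rewrite finset.sub1set => /(_ iS).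
      rewrite sumC big_set1 cards1 /parking_rank -[n.+1%:R]natr1.
      by clear -Snr; move=> h1 h2; lra.
    have iC : i \in ~: S by rewrite finset.in_setC.
    have := C1 i iC; have := C2 (finset.set1 i); rewrite finset.sub1set => /(_ iC).
    rewrite big_set1 cards1 CS /parking_rank natrB//.
    by have := ler0n R #|S|; clear => h0 h1 h2; lra.
  (* Add the inequalities for S \ T and T \ S. The sum is stronger than the claim by |S \ T| |T \
     S|, which is nonnegative. *)
  have TS : T :\: S \subset ~: S by rewrite finset.setDE finset.subsetIr.
  have := S2 (S :\: T) (finset.subsetDl _ _); have := C2 (T :\: S) TS.
  rewrite sumC CS /excess.
  have -> : \sum_(i in S) (tnth t i - 1) =
      \sum_(i in S :&: T) (tnth t i - 1) + \sum_(i in S :\: T) (tnth t i - 1).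
    exact: big_setID.
  have -> : \sum_(i in T) (tnth t i - 1) =
      \sum_(i in S :&: T) (tnth t i - 1) + \sum_(i in T :\: S) (tnth t i - 1).
    by rewrite finset.setIC; exact: big_setID.
  have := ler0n R #|S :\: T|; have := ler0n R #|T :\: S|; rewrite /parking_rank natrB//.
  have -> : #|T| = (#|S :&: T| + #|T :\: S|)%N by rewrite finset.setIC cardsID.
  have -> : #|S| = (#|S :&: T| + #|S :\: T|)%N by rewrite cardsID.
  rewrite !natrD => v0 u0; have := mulr_ge0 u0 v0; clear; lra.
move=> [t1 tmax]; split; apply/parking_ineq_enum; split.
- by move=> i _; case/andP: (t1 i) => _ ti; rewrite -[n.+1%:R]natr1; lra.
- move=> U US; rewrite sumC; have := tmax (S :\: U); rewrite /excess.
  have -> : \sum_(i in S) (tnth t i - 1) =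
      \sum_(i in U) (tnth t i - 1) + \sum_(i in S :\: U) (tnth t i - 1).
    by rewrite -{1}(finset.setIidPr US); exact: big_setID.
  have -> : #|S| = (#|U| + #|S :\: U|)%N by rewrite -{1}(finset.setIidPr US) cardsID.
  rewrite /parking_rank !natrD; clear; lra.
- by move=> i _; case/andP: (t1 i).
- move=> U US; have SU : fintype.disjoint (mem S) (mem U).
    by rewrite disjoint_sym finset.disjoints_subset.
  have := tmax (S :|: U); rewrite /excess.
  have -> : #|S :|: U| = (#|S| + #|U|)%N.
    by rewrite cardsU disjoint_setI0// cards0 subn0.
  have -> : \sum_(i in S :|: U) (tnth t i - 1) =
      \sum_(i in S) (tnth t i - 1) + \sum_(i in U) (tnth t i - 1).
    by rewrite -bigU//=; apply: eq_bigl => i; rewrite finset.in_setU.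
  rewrite CS /parking_rank natrB// natrD; clear; lra.
Qed.

Lemma measurable_parking_cell n (S : {set 'I_n}) : measurable (parking_cell S).
Proof.
apply: measurableI.
  apply: (@measurable_parking_ineq _ _ _ (fun i (t : n.-tuple mR) => n.+1%:R - tnth t i)).
  by move=> i; apply: measurable_funB => //; exact: measurable_tnth.
apply: (@measurable_parking_ineq _ _ _ (fun i (t : n.-tuple mR) => tnth t i)) => i.
exact: measurable_tnth.
Qed.

Lemma seq_measurable_parking_ineq : seq_measurable (@parking_ineq R).
Proof.
move=> n; rewrite (_ : tuples n _ =
    [set t : n.-tuple mR | parking_ineq [seq tnth t i | i <- enum [set: 'I_n]%SET]]).
  apply: (@measurable_parking_ineq _ _ _ (fun i (t : n.-tuple mR) => tnth t i)) => i.
  exact: measurable_tnth.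
apply/seteqP; split=> t; rewrite /= map_tnth_enum_setT; exact.
Qed.

Lemma seq_measurable_parking_ineq_reflection (c : R) :
  seq_measurable [set s | parking_ineq [seq c - x | x <- s]].
Proof.
move=> n; rewrite (_ : tuples n _ =
    [set t : n.-tuple mR | parking_ineq [seq c - tnth t i | i <- enum [set: 'I_n]%SET]]).
  apply: (@measurable_parking_ineq _ _ _ (fun i (t : n.-tuple mR) => c - tnth t i)) => i.
  by apply: measurable_funB => //; exact: measurable_tnth.
have mapE (t : n.-tuple R) :
    [seq c - x | x <- t] = [seq c - tnth t i | i <- enum [set: 'I_n]%SET].
  by rewrite -[in LHS](map_tnth_enum_setT t) -map_comp.
by apply/seteqP; split=> t; rewrite /tuples/= mapE.
Qed.

(** The membership mask of S separates the two conditions on disjoint coordinates, and reflecting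
    the coordinates in S preserves the measure. *)
Lemma seq_measure_parking_cell n (S : {set 'I_n}) :
  lebesgue_tuple n (parking_cell S) =
  (seq_measure #|S| (@parking_ineq R) * seq_measure #|~: S| (@parking_ineq R))%E.
Proof.
rewrite -(seq_measure_reflection #|S| n.+1%:R seq_measurable_parking_ineq).
pose m := [seq i \in S | i <- enum 'I_n].
have filterE (T : {set 'I_n}) : [seq i <- enum 'I_n | i \in T] = enum T.
  by rewrite /enum_mem -filter_predI; apply: eq_filter => i /=; rewrite andbT.
have mE (t : n.-tuple mR) : mask m t = [seq tnth t i | i <- enum S].
  by rewrite -[X in mask _ X](map_tnth_enum t) -map_mask -filter_mask filterE.
have nmE (t : n.-tuple mR) : mask (map negb m) t = [seq tnth t i | i <- enum (~: S)].
  rewrite -[X in mask _ X](map_tnth_enum t) -map_mask -map_comp -filter_mask -filterE.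
  by congr map; apply: eq_filter => i; rewrite finset.in_setC.
have sm : size m = n by rewrite size_map -cardE card_ord.
have cS : count id m = #|S| by rewrite count_map cardE -filterE size_filter.
have cC : count negb m = #|~: S|.
  rewrite count_map cardE -filterE size_filter; apply: eq_count => i.
  by rewrite finset.in_setC.
rewrite -cS -cC -seq_measure_mask; first last.
- exact: seq_measurable_parking_ineq.
- exact: seq_measurable_parking_ineq_reflection.
rewrite sm /seq_measure; congr lebesgue_tuple; apply/seteqP.
by split=> t; rewrite /tuples/parking_cell/= mE nmE -map_comp.
Qed.

(** Ties form a hyperplane whose normal vector is the difference of the indicators of S and T,
    nonzero when S and T differ. *)
Lemma excess_tie n (S T : {set 'I_n}) (t : n.-tuple R) : excess t S = excess t T <->
  \sum_(i < n) ((i \in S)%:R - (i \in T)%:R) * nth 0 t i =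
  #|S|%:R - #|T|%:R + parking_rank R n #|S| - parking_rank R n #|T|.
Proof.
have sumE (U : {set 'I_n}) : \sum_(i in U) (tnth t i - 1) =
    \sum_(i < n) (i \in U)%:R * nth 0 t i - #|U|%:R.
  rewrite sumrB sumr_const; congr (_ - _); rewrite big_mkcond; apply: eq_bigr => i _.
  by rewrite -tnth_nth; case: (i \in U); rewrite ?mul1r ?mul0r.
under eq_bigr do rewrite mulrBl.
by rewrite /excess !sumE sumrB; split; lra.
Qed.

Lemma measurable_excess_tie n (S T : {set 'I_n}) :
  measurable [set t : n.-tuple mR | excess t S = excess t T].
Proof.
have := @seq_measurable_hyperplane R n (fun i => (i \in S)%:R - (i \in T)%:R)
  (#|S|%:R - #|T|%:R + parking_rank R n #|S| - parking_rank R n #|T|) n.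
by congr measurable; apply/seteqP; split=> t; rewrite /tuples/= excess_tie.
Qed.

Lemma excess_tie_null n (S T : {set 'I_n}) : S != T ->
  lebesgue_tuple n [set t : n.-tuple mR | excess t S = excess t T] = 0%E.
Proof.
move=> ST; have [i iST] : exists i, (i \in S) != (i \in T).
  by apply/existsP; apply: contraNT ST => /existsPn h; apply/eqP/finset.setP => i;
    apply/eqP; rewrite -[_ == _]negbK.
rewrite -[RHS](@seq_measure_hyperplane R n (fun i => (i \in S)%:R - (i \in T)%:R)
  (#|S|%:R - #|T|%:R + parking_rank R n #|S| - parking_rank R n #|T|) i).
  by congr lebesgue_tuple; apply/seteqP; split=> t; rewrite /tuples/= excess_tie.
rewrite subr_eq0; move: iST; case: (i \in S); case: (i \in T) => //= _.
  by rewrite oner_eq0.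
by rewrite eq_sym oner_eq0.
Qed.

Definition parking_box n : set (n.-tuple mR) := [set t | forall i, 1 <= tnth t i <= n%:R].

Arguments parking_box n : clear implicits.

Lemma measurable_parking_box n : measurable (parking_box n).
Proof.
apply: (@measurable_forall _ _ _ (fun i => [set t : n.-tuple mR | 1 <= tnth t i <= n%:R])).
move=> i; rewrite (_ : [set t | _] = setT `&` (@tnth n mR)^~ i @^-1` `[1, n%:R]).
  by apply: measurable_tnth => //; exact: measurable_itv.
by rewrite setTI; apply/seteqP; split=> t /=; rewrite in_itv.
Qed.

(** N is the null set of all ties. Outside N each point of the box has exactly one maximizer of
    [excess], so the cells partition the box up to N. *)
Lemma sum_parking_cell n :
  (\sum_(S : {set 'I_n}) lebesgue_tuple n (parking_cell S) =
   lebesgue_tuple n (parking_box n))%E.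
Proof.
pose H (p : {set 'I_n} * {set 'I_n}) := [set t : n.-tuple mR | excess t p.1 = excess t p.2].
pose N := \big[setU/set0]_(p : {set 'I_n} * {set 'I_n} | p.1 != p.2) H p.
have [mN N0] : measurable N /\ lebesgue_tuple n N = 0%E.
  rewrite /N; elim/big_ind : _ => [|A B [mA A0] [mB B0]|p pST].
  - by split=> //; exact: measure0.
  - by split; [exact: measurableU|rewrite measureU0].
  - by split; [exact: measurable_excess_tie|exact: excess_tie_null].
have NP S T t : S != T -> excess t S = excess t T -> N t.
  by move=> ST e; rewrite /N (bigD1 (S, T))//=; left.
have nullD A : measurable A -> lebesgue_tuple n (A `\` N) = lebesgue_tuple n A.
  move=> mA; rewrite -[in RHS](setUIDK A N) setUC measureU0//.
  - exact: measurableD.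
  - exact: measurableI.
  - by apply: (subset_measure0 _ mN) => //; exact: measurableI.
have boxE : parking_box n `\` N = \bigcup_(S in [set: {set 'I_n}]) (parking_cell S `\` N).
  apply/seteqP; split=> [t [tbox tN]|t [S _ [/parking_cellP[tbox _] tN]]]; last by split.
  have [S _ Smax] := @Order.TotalTheory.arg_maxP _ _ _ (finset.set0 : {set 'I_n}) predT
    (excess t) isT.
  by exists S => //; split=> //; apply/parking_cellP; split=> // T; exact: Smax.
have mbox := @measurable_parking_box n.
rewrite -[RHS]nullD// boxE measure_fin_bigcup//; last 3 first.
- exact: finite_finset.
- move=> S T _ _ [t [[/parking_cellP[_ Smax] tN] [/parking_cellP[_ Tmax] _]]].
  apply: contrapT => /eqP ST; apply: tN; apply: (NP S T) => //.
  by apply/le_anti; rewrite Smax Tmax.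
- by move=> S _; apply: measurableD => //; exact: measurable_parking_cell.
rewrite (_ : [set: {set 'I_n}] = [set` index_enum {set 'I_n}]).
  rewrite -fsbig_seq ?index_enum_uniq//; apply: eq_bigr => S _.
  by apply/esym/nullD; exact: measurable_parking_cell.
by apply/seteqP; split=> S //= _; rewrite mem_index_enum.
Qed.

Lemma seq_measure_parking0 : seq_measure 0 (@parking_ineq R) = 1%E.
Proof.
rewrite seq_measure0 asboolT//; split=> // s; rewrite subseq0 => /eqP ->.
by rewrite big_nil /parking_rank !mul0r subr0.
Qed.

Lemma lebesgue_parking_box n : (0 < n)%N ->
  lebesgue_tuple n (parking_box n) = ((n%:R - 1) ^+ n)%:E.
Proof.
move=> n0; have := @lebesgue_tuple_box R n (fun=> 1) (fun=> n%:R).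
by rewrite prodr_const card_ord; apply=> _; rewrite ler1n.
Qed.

(** The cell of the empty set has this measure and lies in the box. Finiteness makes [fine] harmless
    in [volume]. *)
Lemma parking_measure_fin_num n : seq_measure n (@parking_ineq R) \is a fin_num.
Proof.
case: n => [|n]; first by rewrite seq_measure_parking0.
have := seq_measure_parking_cell (finset.set0 : {set 'I_n.+1}).
rewrite cards0 seq_measure_parking0 mul1e finset.setC0 cardsT card_ord => <-.
rewrite ge0_fin_numE; last exact: measure_ge0.
apply: (@le_lt_trans _ _ (lebesgue_tuple n.+1 (parking_box n.+1))).
  apply: le_measure; rewrite ?inE.
  - exact: measurable_parking_cell.
  - exact: measurable_parking_box.
  - by move=> t /parking_cellP[].
by rewrite lebesgue_parking_box// ltry.
Qed.

Lemma parking_volumeE n : parking_volume R n = fine (seq_measure n (@parking_ineq R)).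
Proof.
case: n => [|n]; first by rewrite seq_measure_parking0.
rewrite /parking_volume /volume /seq_measure; congr (fine (lebesgue_tuple _ _)).
by apply/seteqP; split=> t /parking_polytopeE.
Qed.

(** Group the cells by k = |S|: there are 'C(n, k) sets of size k, and their cells have equal
    measure. *)
Lemma parking_volume_conv n : (0 < n)%N ->
  \sum_(k < n.+1) 'C(n, k)%:R * (parking_volume R k * parking_volume R (n - k)) =
  (n%:R - 1) ^+ n.
Proof.
move=> n0; apply: EFin_inj; rewrite -lebesgue_parking_box// -sum_parking_cell -sumEFin.
have cellE (S : {set 'I_n}) : lebesgue_tuple n (parking_cell S) =
    (parking_volume R #|S| * parking_volume R (n - #|S|))%:E.
  rewrite seq_measure_parking_cell [#|~: S|]cardsCs finset.setCK card_ord !parking_volumeE EFinM.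
  by rewrite !fineK// parking_measure_fin_num.
under [RHS]eq_bigr do rewrite cellE.
have cardn (S : {set 'I_n}) : (#|S| < n.+1)%N by rewrite ltnS -[X in (_ <= X)%N]card_ord max_card.
rewrite (partition_big (fun S => Ordinal (cardn S)) predT)//=; apply: eq_bigr => k _.
rewrite (eq_bigr (fun=> (parking_volume R k * parking_volume R (n - k))%:E)); last first.
  by move=> S /eqP <-.
have := cards_draws [set: 'I_n]%SET k; rewrite cardsT card_ord => <-.
rewrite sumEFin sumr_const mulr_natl; congr (_ *+ _)%:E; apply: eq_card => S.
by rewrite finset.inE finset.subsetT.
Qed.

End Partition.

Theorem proposition4p3 (R : realType) :
  let f : fps R := egf (parking_volume R) in
  let g : fps R := egf (fun n => if n is m.+1 then (n ^ m)%N%:R else 0) in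
  f = fps_exp (fps_int
        (fps_scale 2^-1 (fps_mul fps_X (fps_pow (fps_deriv g) 2)))).
Proof.
apply: fps_exp_tree; first by rewrite /egf /= divr1.
(* It remains to see that f^2 = A_(-1): up to n!, its coefficients are the binomial convolutions of
   the volumes. *)
apply/funext => n; rewrite fps_coefM /abel_egf /egf.
transitivity ((\sum_(k < n.+1) 'C(n, k)%:R *
    (parking_volume R k * parking_volume R (n - k))) / n`!%:R).
  rewrite mulr_suml; apply: eq_bigr => k _.
  by rewrite [RHS]mulrAC bin_fact_inv -1?ltnS//; ring.
(* For n = 0 both sides are 1, by V_0 = 1 and (-1)^0 = 1. *)
congr (_ / _); case: n => [|n]; last by rewrite parking_volume_conv// addrC.
by rewrite big_ord1 bin0 !mul1r expr0.
Qed.
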